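(* Let $H$ be a Hilbert space, let $N$ and $M$ be closed subspaces of $H$ in generic position, and let $\mathcal{A}$ be the algebra of all operators in $\mathcal{B}(H)$ that leave both $N$ and $M$ invariant. Then $\mathcal{A}$ satisfies property (V') if and only if the angle between $N$ and $M$ is positive.
   Context: $\mathcal{B}(H)$ is the algebra of all bounded linear operators on $H$. Closed subspaces $N$ and $M$ of $H$ are in generic position if $N\cap M=N^{\perp}\cap M=M^{\perp}\cap N=M^{\perp}\cap N^{\perp}=\{0\}$. The angle between $N$ and $M$ is said to be positive if the algebraic sum $N+M$ is closed; otherwise the angle is said to be zero. For a unital operator algebra $\mathcal{A}\subseteq\mathcal{B}(H)$, $\mathrm{Lat}\,\mathcal{A}$ denotes the set of all projections (self-adjoint idempotents) $L\in\mathcal{B}(H)$ with $(I-L)AL=0$ for all $A\in\mathcal{A}$. For $x,y\in H$, $\omega_{x,y}(T)=(Tx,y)$ for $T\in\mathcal{B}(H)$, and $\|\omega_{x,y}|_{\mathcal{A}}\|=\sup\{|(Ax,y)| : A\in\mathcal{A},\ \|A\|\le 1\}$. The algebra $\mathcal{A}$ satisfies property (V') if there exists a constant $c>0$ such that $$\inf_{L\in \mathrm{Lat}\,\mathcal{A}} \left(\|(I-L)x\|^2 + \|Ly\|^2\right) \leq c\,\|\omega_{x,y}|_{\mathcal{A}}\| \quad\text{for all } x,y\in H.$$ *)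

(* Defs.v *)
From HB Require Import structures.
From mathcomp Require Import all_boot all_order all_algebra.
From mathcomp Require Import complex.
From mathcomp Require Import all_classical all_reals all_analysis.

Set Implicit Arguments.
Unset Strict Implicit.
Unset Printing Implicit Defensive.

Import Order.TTheory GRing.Theory Num.Theory.
Import numFieldNormedType.Exports.

Local Open Scope classical_set_scope.
Local Open Scope complex_scope.
Local Open Scope ring_scope.

(* A Hilbert space over the complex numbers R[i]: complete for the norm of an
   inner product, which is linear in its first argument and conjugate-linear in
   the second one. *)
HB.mixin Record CompleteNormedModule_isHilbert (R : realType) H
    of CompleteNormedModule R[i] H := {
  inner : {dot H for (@Num.conj R[i])} ;
  sqr_norm_inner : forall x : H, `|x| ^+ 2 = inner x x
}.

#[short(type="hilbertType")]
HB.structure Definition Hilbert (R : realType) :=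
  {H of CompleteNormedModule R[i] H & CompleteNormedModule_isHilbert R H}.

(* `|v| lives in R[i], where it is a nonnegative real; rnorm v is the same
   number as an element of R, so that suprema and infima can be taken. *)
Definition rnorm (R : realType) (V : normedZmodType R[i]) (v : V) : R :=
  complex.Re `|v|.

Section Hilbert_defs.
Context {R : realType} {H : hilbertType R}.
Implicit Types (N M : set H) (T L : {linear H -> H}) (A : set {linear H -> H}).

Definition closed_subspace N : Prop :=
  [/\ N 0, forall (a : R[i]) (u v : H), N u -> N v -> N (a *: u + v) & closed N].

Definition orthocomp N : set H := [set x | forall y, N y -> inner x y = 0].

Definition generic_position N M : Prop :=
  [/\ N `&` M = [set 0], orthocomp N `&` M = [set 0],
      orthocomp M `&` N = [set 0] & orthocomp M `&` orthocomp N = [set 0]].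

Definition positive_angle N M : Prop :=
  closed [set x + y | x in N & y in M].

Definition bounded_operators : set {linear H -> H} :=
  [set T | exists c : R, forall x : H, rnorm (T x) <= c * rnorm x].

Definition opnorm T : R := sup [set rnorm (T x) | x in [set x | rnorm x <= 1]].

Definition invariant_algebra N M : set {linear H -> H} :=
  [set T | [/\ bounded_operators T, T @` N `<=` N & T @` M `<=` M]].

Definition projection L : Prop :=
  [/\ bounded_operators L, forall x, L (L x) = L x
    & forall x y, inner (L x) y = inner x (L y)].

(* (I - L) T L = 0 *)
Definition Lat A : set {linear H -> H} :=
  [set L | projection L /\
           forall T, A T -> forall x, T (L x) - L (T (L x)) = 0].

Definition omega (x y : H) T : R[i] := inner (T x) y.

Definition omega_norm A (x y : H) : R :=
  sup [set rnorm (omega x y T) | T in [set T | A T /\ opnorm T <= 1]].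

(* For A included in bounded_operators and 0 in A, every set whose sup or inf
   is taken here is nonempty and bounded. *)
Definition property_V' A : Prop :=
  exists2 c : R, 0 < c & forall x y : H,
    inf [set rnorm (x - L x) ^+ 2 + rnorm (L y) ^+ 2 | L in Lat A]
      <= c * omega_norm A x y.

End Hilbert_defs.

(* Main.v *)
(* Let P and Q be the orthogonal projections onto N and M. The rank-one operators
   in the algebra are those z |-> (z, v) u with u in N and v orthogonal to M, or
   the other way round. They force Lat A = {0, N, M, H}, and they give
   |omega_{x,y}| >= |x - Q x| |P y| and |omega_{x,y}| >= |x - P x| |Q y|.

   If N + M is closed, then N + M = H, and uniform boundedness gives
   |y| <= c (|P y| + |Q y|) and |x| <= c (|x - P x| + |x - Q x|); so choosing L
   among 0, N, M, H makes |x - L x|^2 + |L y|^2 comparable to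
   min(|x - Q x|, |P y|)^2 + min(|x - P x|, |Q y|)^2, which is at most
   2 |omega_{x,y}|.

   If N + M is not closed, there is u orthogonal to M such that w = P u is nonzero
   and |w - Q w| <= d |w|, with d as small as we like. With p = Q w - P (Q w),
   x = Q w + p and y = (u + w) / 2, one finds (T x, y) = (T p, w) for all T in A,
   of size at most d |w|^2, whereas |x - L x|^2 + |L y|^2 >= |w|^2 / 16 for each of
   the four L. *)
From HB Require Import structures.
Require Import Defs.
From mathcomp Require Import all_boot all_order all_algebra.
From mathcomp Require Import complex.
From mathcomp Require Import all_classical all_reals all_analysis.
From mathcomp Require Import ring lra.

Set Implicit Arguments.
Unset Strict Implicit.
Unset Printing Implicit Defensive.

Import Order.TTheory GRing.Theory Num.Theory.
Import numFieldNormedType.Exports.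

Local Open Scope classical_set_scope.
Local Open Scope complex_scope.
Local Open Scope ring_scope.

(** * Hilbert space geometry *)

Section rnorm.
Context {R : realType} {V : normedZmodType R[i]}.
Implicit Types (v w : V).

Lemma normc_rnorm v : `|v| = (rnorm v)%:C.
Proof.
have := normr_ge0 v; rewrite /rnorm lecE => /andP[/eqP + _].
by case: `|v| => a b /= ->.
Qed.

Lemma rnorm_ge0 v : 0 <= rnorm v.
Proof. by rewrite -ler0c -normc_rnorm. Qed.

Lemma rnormD v w : rnorm (v + w) <= rnorm v + rnorm w.
Proof. by rewrite -lecR rmorphD/= -!normc_rnorm ler_normD. Qed.

Lemma rnormN v : rnorm (- v) = rnorm v.
Proof. by rewrite /rnorm normrN. Qed.

Lemma rdistC v w : rnorm (v - w) = rnorm (w - v).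
Proof. by rewrite /rnorm distrC. Qed.

Lemma rnormB v w : rnorm (v - w) <= rnorm v + rnorm w.
Proof. by rewrite -(rnormN w) rnormD. Qed.

Lemma rnorm0 : rnorm (0 : V) = 0.
Proof. by rewrite /rnorm normr0. Qed.

Lemma rnorm_eq0 v : (rnorm v == 0) = (v == 0).
Proof. by rewrite -(normr_eq0 v) normc_rnorm -(inj_eq (@complexI R)). Qed.

Lemma rnorm_gt0 v : (0 < rnorm v) = (v != 0).
Proof. by rewrite lt_def rnorm_eq0 rnorm_ge0 andbT. Qed.

End rnorm.

Section rnorm_complex.
Context {R : realType}.
Implicit Types (z a : R[i]).

Lemma rnormM a z : rnorm (a * z) = rnorm a * rnorm z.
Proof. by apply: complexI; rewrite rmorphM/= -!normc_rnorm normrM. Qed.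

Lemma rnormC (a : R) : rnorm a%:C = `|a|.
Proof. by rewrite /rnorm /Num.norm/= expr0n/= addr0 sqrtr_sqr. Qed.

End rnorm_complex.

Section inner.
Context {R : realType} {H : hilbertType R}.
Implicit Types (x y z : H) (a : R[i]).

Lemma rnormZ a x : rnorm (a *: x) = rnorm a * rnorm x.
Proof. by apply: complexI; rewrite rmorphM/= -!normc_rnorm normrZ. Qed.

Lemma innerC x y : inner x y = Num.conj (inner y x).
Proof. by rewrite hermC/= expr0 mul1r. Qed.

Lemma innerDl x y z : inner (x + y) z = inner x z + inner y z.
Proof. exact: linearDl. Qed.

Lemma innerBl x y z : inner (x - y) z = inner x z - inner y z.
Proof. exact: linearBl. Qed.

Lemma innerZl a x z : inner (a *: x) z = a * inner x z.
Proof. exact: linearZl_LR. Qed.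

Lemma inner0l z : inner (0 : H) z = 0.
Proof. exact: linear0l. Qed.

Lemma innerDr x y z : inner z (x + y) = inner z x + inner z y.
Proof. exact: linearDr. Qed.

Lemma innerBr x y z : inner z (x - y) = inner z x - inner z y.
Proof. exact: linearBr. Qed.

Lemma innerZr a x z : inner z (a *: x) = Num.conj a * inner z x.
Proof. exact: linearZr_LR. Qed.

Lemma inner0r z : inner z (0 : H) = 0.
Proof. exact: linear0r. Qed.

Lemma inner_eq0C x y : inner x y = 0 -> inner y x = 0.
Proof. by move=> e; rewrite innerC e rmorph0. Qed.

Lemma inner_self x : inner x x = ((rnorm x ^+ 2)%:C : R[i]).
Proof. by rewrite rmorphXn/= -normc_rnorm sqr_norm_inner. Qed.

Lemma inner_self_eq0 x : inner x x = 0 -> x = 0.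
Proof.
rewrite inner_self => /complexI/eqP.
by rewrite expf_eq0/= rnorm_eq0 => /eqP.
Qed.

Lemma pythagoras x y : inner x y = 0 ->
  rnorm (x + y) ^+ 2 = rnorm x ^+ 2 + rnorm y ^+ 2.
Proof.
move=> xy; apply: complexI; rewrite rmorphD/= -!inner_self.
by rewrite innerDl !innerDr xy (inner_eq0C xy) addr0 add0r.
Qed.

Lemma parallelogram x y :
  rnorm (x + y) ^+ 2 + rnorm (x - y) ^+ 2
    = 2 * rnorm x ^+ 2 + 2 * rnorm y ^+ 2.
Proof.
apply: complexI; rewrite !rmorphD !(rmorphM _ 2)/= -!inner_self.
rewrite !innerBl !innerDl !innerBr !innerDr.
have -> : (2%:R)%:C = 2%:R :> R[i] by rewrite rmorph_nat.
ring.
Qed.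

(** Pythagoras for the component of [x] along [y]. Nonnegativity of the left side gives
    Cauchy-Schwarz, and the exact value gives the orthogonality of [x - p] to a subspace when [p] is
    its nearest point to [x]. *)
Lemma sqr_rnorm_sub_inner x y : y != 0 ->
  rnorm (x - (inner x y / inner y y) *: y) ^+ 2
    = rnorm x ^+ 2 - rnorm (inner x y) ^+ 2 / rnorm y ^+ 2.
Proof.
move=> y0.
have yy0 : inner y y != 0 by apply: contra_neq y0; exact: inner_self_eq0.
set z := (_ / _) *: y.
have zy : inner (x - z) z = 0.
  by rewrite innerZr innerBl innerZl divfK// subrr mulr0.
have -> : rnorm x ^+ 2 = rnorm (x - z) ^+ 2 + rnorm z ^+ 2.
  by rewrite -(pythagoras zy) subrK.
have -> : rnorm z ^+ 2 = rnorm (inner x y) ^+ 2 / rnorm y ^+ 2.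
  have ny : rnorm y != 0 by rewrite rnorm_eq0.
  rewrite /z rnormZ rnormM inner_self -fmorphV/= rnormC.
  rewrite ger0_norm ?invr_ge0 ?sqr_ge0//; field.
  exact: ny.
by rewrite addrK.
Qed.

Lemma cauchy_schwarz x y : rnorm (inner x y) <= rnorm x * rnorm y.
Proof.
have [->|y0] := eqVneq y 0; first by rewrite inner0r !rnorm0 mulr0.
rewrite -ler_sqr ?nnegrE ?mulr_ge0 ?rnorm_ge0// exprMn.
rewrite -ler_pdivrMr ?exprn_gt0 ?rnorm_gt0// -subr_ge0.
by rewrite -sqr_rnorm_sub_inner// sqr_ge0.
Qed.

End inner.

(** * Closedness and completeness in terms of the real-valued norm *)

Section completeness.
Context {R : realType} {H : hilbertType R}.
Implicit Types (x y : H) (A N : set H) (u : nat -> H).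

Lemma gt0_complexE (e : R[i]) : 0 < e -> e = (complex.Re e)%:C.
Proof.
by case: e => a b; rewrite ltcE/= => /andP[/eqP-> _]; rewrite complexr0.
Qed.

Lemma ball_rnorm x (e : R) : ball x e%:C = [set y | rnorm (x - y) < e].
Proof.
by rewrite -ball_normE; apply/seteqP; split=> y /=; rewrite normc_rnorm ltcR.
Qed.

(** Balls have radii in [R[i]], but a positive element of [R[i]] has zero imaginary part, so real
    radii suffice. *)
Lemma closed_rnormP A : closed A <->
  forall x, (forall e : R, 0 < e -> exists2 a, A a & rnorm (x - a) < e) -> A x.
Proof.
split=> [cA x Ax|cA x Ax].
  apply: cA => B /nbhs_ballP[e /= e0 xeB].
  have eE := gt0_complexE e0.
  have {}/Ax[a Aa xa] : 0 < complex.Re e by rewrite -ltcR -eE.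
  by exists a; split => //; apply: xeB; rewrite eE ball_rnorm.
apply: cA => e e0.
have [a [Aa xa]] : A `&` ball x e%:C !=set0.
  by apply: Ax; apply: nbhsx_ballx; rewrite ltcR.
by exists a => //; move: xa; rewrite ball_rnorm.
Qed.

Lemma invS_small (t : R) : 0 < t ->
  exists n, forall m, (n <= m)%N -> m.+1%:R^-1 < t.
Proof.
by move=> t0; have [n _ nt] := near_infty_natSinv_lt (PosNum t0); exists n.
Qed.

Definition rconverges u x :=
  forall e : R, 0 < e -> exists n, forall m, (n <= m)%N -> rnorm (x - u m) < e.

Lemma rcauchy_converges u :
  (forall e : R, 0 < e ->
     exists n, forall m, (n <= m)%N -> rnorm (u n - u m) < e) ->
  exists x, rconverges u x.
Proof.
move=> cu.
have : cvg (u @ \oo).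
  apply: cauchy_cvg; apply: cauchy_exP => e e0.
  have eE := gt0_complexE e0.
  have {}/cu[n un] : 0 < complex.Re e by rewrite -ltcR -eE.
  exists (u n); exists n => // m /= nm.
  by rewrite eE ball_rnorm; exact: un.
move/cvg_ex => [x ux]; exists x => e e0.
have /ux[n _ un] : nbhs x (ball x e%:C) by apply: nbhsx_ballx; rewrite ltcR.
by exists n => m nm; have := un m nm; rewrite /= ball_rnorm.
Qed.

Lemma closed_rconverges A u x : closed A -> (forall n, A (u n)) ->
  rconverges u x -> A x.
Proof.
move=> /closed_rnormP cA Au ux; apply: cA => e /ux[n un].
by exists (u n); [exact: Au | exact: un].
Qed.

End completeness.

(** * Closed subspaces, nearest points and existence of orthogonal projections *)

Section subspaces.
Context {R : realType} {H : hilbertType R}.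
Implicit Types (x y : H) (N M : set H) (P : {linear H -> H}).

Lemma subspace0 N : closed_subspace N -> N 0.
Proof. by case. Qed.

Lemma subspaceZ N (a : R[i]) x : closed_subspace N -> N x -> N (a *: x).
Proof. by case=> N0 NP _ Nx; rewrite -[_ *: _]addr0; exact: NP. Qed.

Lemma subspaceD N x y : closed_subspace N -> N x -> N y -> N (x + y).
Proof. by case=> _ NP _ Nx Ny; rewrite -[x]scale1r; exact: NP. Qed.

Lemma subspaceN N x : closed_subspace N -> N x -> N (- x).
Proof. by move=> cN Nx; rewrite -scaleN1r; exact: subspaceZ. Qed.

Lemma subspaceB N x y : closed_subspace N -> N x -> N y -> N (x - y).
Proof. by move=> cN Nx Ny; apply: subspaceD => //; exact: subspaceN. Qed.

Lemma orthocomp_closed N : closed_subspace (orthocomp N).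
Proof.
split=> [y _|a u v Nu Nv y Ny|]; first by rewrite inner0l.
  by rewrite innerDl innerZl Nu// Nv// mulr0 addr0.
apply/closed_rnormP => x xN y Ny; apply/eqP; rewrite -rnorm_eq0.
apply/eqP/le_anti; rewrite rnorm_ge0 andbT.
apply/ler_addgt0Pr => e e0; rewrite add0r.
(* Adding 1 makes the division legitimate when [y] is 0. *)
have y0 : 0 < rnorm y + 1 by rewrite ltr_wpDl// rnorm_ge0.
have [|a aN xa] := xN (e / (rnorm y + 1)); first by rewrite divr_gt0.
have -> : inner x y = inner (x - a) y by rewrite innerBl aN// subr0.
apply: le_trans (cauchy_schwarz _ _) _.
rewrite -[leRHS](divfK (lt0r_neq0 y0)) ler_pM ?rnorm_ge0// ?ltW//.
by rewrite ltr_pwDr.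
Qed.

(** A minimizing sequence is Cauchy: midpoints of its terms stay in [N], hence at distance at least
    [d] from [x], and the parallelogram law then bounds the distance between the terms. *)
Lemma nearest_point N x : closed_subspace N ->
  exists2 p, N p & forall y, N y -> rnorm (x - p) <= rnorm (x - y).
Proof.
move=> cN; pose D := [set rnorm (x - y) | y in N]; pose d := inf D.
have Dlb : has_lbound D by exists 0 => _ [y _ <-]; exact: rnorm_ge0.
have D0 : D !=set0 by exists (rnorm (x - 0)), 0 => //; exact: subspace0.
have dle y : N y -> d <= rnorm (x - y).
  by move=> Ny; apply: ge_inf => //; exists y.
have d0 : 0 <= d by apply: lb_le_inf => // _ [y _ <-]; exact: rnorm_ge0.
have /choice[u uP] : forall n : nat,
    exists y, N y /\ rnorm (x - y) < d + n.+1%:R^-1.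
  move=> n.
  have n0 : 0 < n.+1%:R^-1 :> R by [].
  have [_ [y Ny <-] ydn] := inf_adherent n0 (conj D0 Dlb).
  by exists y.
have [p up] : exists p, rconverges u p.
  apply: rcauchy_converges => e e0.
  (* If [u n] and [u m] are both within [d + t] of [x], the parallelogram law bounds their squared
     distance by [4 * (d + t) ^+ 2 - 4 * d ^+ 2]. For [t <= 1] this is at most
     [4 * (2 * d + 1) * t], hence at most [e ^+ 2]. *)
  pose t := Num.min 1 (e ^+ 2 / (4 * (2 * d + 1))).
  have t0 : 0 < t.
    by rewrite lt_min ltr01 divr_gt0 ?exprn_gt0// mulr_gt0// ltr_wpDl// mulr_ge0.
  have [n nt] := invS_small t0; exists n => m nm.
  have [[Nn un] [Nm um]] := (uP n, uP m).
  rewrite rdistC -ltr_sqr ?nnegrE ?rnorm_ge0 ?(ltW e0)//.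
  have -> : u m - u n = (x - u n) - (x - u m).
    by rewrite opprB [RHS]addrC addrA subrK.
  have := parallelogram (x - u n) (x - u m).
  have : (2 * d) ^+ 2 <= rnorm (x - u n + (x - u m)) ^+ 2.
    rewrite ler_sqr ?nnegrE ?rnorm_ge0 ?mulr_ge0//.
    have -> : x - u n + (x - u m) =
        (2%:R : R)%:C *: (x - (2^-1 : R)%:C *: (u n + u m)).
      rewrite scalerBr scalerA -rmorphM/= mulfV ?pnatr_eq0// scale1r.
      by rewrite (rmorph_nat (real_complex R)) scaler_nat mulr2n opprD addrACA.
    rewrite rnormZ rnormC ger0_norm// ler_pM2l//; apply: dle.
    by apply: subspaceZ => //; exact: subspaceD.
  have {}un : rnorm (x - u n) < d + t by apply: lt_trans un _; rewrite ltrD2l nt.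
  have {}um : rnorm (x - u m) < d + t by apply: lt_trans um _; rewrite ltrD2l nt.
  have t1 : t <= 1 by rewrite ge_min lexx.
  have te : 4 * (2 * d + 1) * t <= e ^+ 2.
    rewrite mulrC -ler_pdivlMr; first by rewrite ge_min lexx orbT.
    by rewrite mulr_gt0// ltr_wpDl// mulr_ge0.
  have {}un : rnorm (x - u n) ^+ 2 < (d + t) ^+ 2.
    by rewrite ltr_sqr ?nnegrE ?rnorm_ge0// addr_ge0// ltW.
  have {}um : rnorm (x - u m) ^+ 2 < (d + t) ^+ 2.
    by rewrite ltr_sqr ?nnegrE ?rnorm_ge0// addr_ge0// ltW.
  have tt : t ^+ 2 <= t by rewrite expr2 ger_pMl.
  lra.
have Np : N p.
  by apply: closed_rconverges up => [|n]; [case: cN | have [] := uP n].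
exists p => // y /dle; apply: le_trans.
suff near_d (e : R) : 0 < e -> rnorm (x - p) <= d + e by exact/ler_addgt0Pr.
move=> e0; have e20 : 0 < e / 2 by rewrite divr_gt0.
have [[n nu] [k kt]] := (up _ e20, invS_small e20).
pose m := maxn n k.
have := nu m (leq_maxl _ _); have := kt m (leq_maxr _ _).
have [_ um] := uP m.
have := rnormB (x - u m) (p - u m); rewrite opprB addrA subrK.
by move: um; move: (_^-1) => t; lra.
Qed.

Definition orthoproj N P :=
  (forall x, N (P x)) /\ (forall x, orthocomp N (x - P x)).

Lemma orthoproj_exists N : closed_subspace N -> exists P, orthoproj N P.
Proof.
move=> cN.
have /choice[f fP] : forall x, exists p, N p /\ orthocomp N (x - p).
  move=> x.
  have [p Np px] := nearest_point x cN; exists p; split=> // y Ny.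
  have [->|y0] := eqVneq y 0; first by rewrite inner0r.
  (* The point [p + t *: y] of [N] would be strictly closer to [x] than [p] unless [inner (x - p) y]
     vanishes. *)
  pose t := inner (x - p) y / inner y y.
  have : rnorm (x - p) ^+ 2 <= rnorm (x - p - t *: y) ^+ 2.
    rewrite ler_sqr ?nnegrE ?rnorm_ge0// -addrA -opprD; apply: px.
    by apply: subspaceD => //; exact: subspaceZ.
  rewrite sqr_rnorm_sub_inner// lerDl oppr_ge0.
  rewrite pmulr_lle0 ?invr_gt0 ?exprn_gt0 ?rnorm_gt0// => t0.
  have : rnorm (inner (x - p) y) ^+ 2 == 0 by rewrite eq_le t0 sqr_ge0.
  by rewrite sqrf_eq0 rnorm_eq0 => /eqP.
(* Linearity of the chosen [f] comes from uniqueness: [a *: f x + f y] satisfies both conditions for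
   [a *: x + y]. *)
have uniq x p : N p -> orthocomp N (x - p) -> f x = p.
  move=> Np px; have [Nf fx] := fP x.
  have Nd : N (f x - p) by exact: subspaceB.
  apply/eqP; rewrite -subr_eq0; apply/eqP/inner_self_eq0.
  have {1}-> : f x - p = (x - p) - (x - f x).
    by rewrite opprB [RHS]addrC addrA subrK.
  by rewrite innerBl px// fx// subr0.
have lf : linear f.
  move=> a x y; have [[Nx fx] [Ny fy]] := (fP x, fP y).
  apply: uniq => [|z Nz]; first by case: cN => _ + _; exact.
  rewrite opprD addrACA -scalerBr innerDl innerZl fx// fy//.
  by rewrite mulr0 addr0.
pose P : {linear H -> H} := HB.pack f (GRing.isLinear.Build _ _ _ _ _ lf).
by exists P; split=> x; have [] := fP x.
Qed.

End subspaces.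

(** * Properties of one orthogonal projection, then of a pair of them *)

Section orthoproj.
Context {R : realType} {H : hilbertType R}.
Implicit Types (x y : H) (N M : set H) (P Q : {linear H -> H}).

Section one_subspace.
Variables (N : set H) (P : {linear H -> H}).
Hypotheses (cN : closed_subspace N) (NP : orthoproj N P).

Lemma orthoproj_sub x : orthocomp N (x - P x). Proof. exact: NP.2. Qed.

Lemma orthoproj_orth x y : N y -> inner (P x) y = inner x y.
Proof.
by move=> Ny; apply/eqP; rewrite eq_sym -subr_eq0 -innerBl orthoproj_sub.
Qed.

Lemma orthoproj_selfadjoint x y : inner (P x) y = inner x (P y).
Proof.
rewrite -(orthoproj_orth x (NP.1 y)) [LHS]innerC [RHS]innerC.
by rewrite (orthoproj_orth y (NP.1 x)).
Qed.

Lemma orthoproj_uniq x p : N p -> orthocomp N (x - p) -> P x = p.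
Proof.
move=> Np xp; apply/eqP; rewrite -subr_eq0; apply/eqP/inner_self_eq0.
have Nd : N (P x - p) by apply: subspaceB => //; exact: NP.1.
by rewrite innerBl orthoproj_orth// -innerBl xp.
Qed.

Lemma orthoproj_id x : N x -> P x = x.
Proof. by move=> Nx; apply: orthoproj_uniq => // y _; rewrite subrr inner0l. Qed.

Lemma orthoproj_eq0 x : orthocomp N x -> P x = 0.
Proof.
by move=> Nx; apply: orthoproj_uniq; [exact: subspace0 | rewrite subr0].
Qed.

Lemma orthoproj_pythagoras x :
  rnorm x ^+ 2 = rnorm (P x) ^+ 2 + rnorm (x - P x) ^+ 2.
Proof.
rewrite addrC -pythagoras ?subrK//; exact/orthoproj_sub/NP.1.
Qed.

Lemma orthoproj_le x : rnorm (P x) <= rnorm x.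
Proof.
rewrite -ler_sqr ?nnegrE ?rnorm_ge0// (orthoproj_pythagoras x).
by rewrite lerDl sqr_ge0.
Qed.

Lemma orthoproj_sub_le x : rnorm (x - P x) <= rnorm x.
Proof.
rewrite -ler_sqr ?nnegrE ?rnorm_ge0// (orthoproj_pythagoras x).
by rewrite lerDr sqr_ge0.
Qed.

Lemma orthoproj_nearest x y : N y -> rnorm (x - P x) <= rnorm (x - y).
Proof.
move=> Ny; rewrite -[leLHS](_ : rnorm ((x - y) - P (x - y)) = _).
  exact: orthoproj_sub_le.
by rewrite linearB/= (orthoproj_id Ny) opprB addrA subrK.
Qed.

(** The vector [x - P x] lies in the orthocomplement of [N], so it is orthogonal both to [x] and to
    [P x], hence to itself. *)
Lemma orthocompK x : orthocomp (orthocomp N) x -> N x.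
Proof.
move=> Nx; suff -> : x = P x by exact: NP.1.
apply/eqP; rewrite -subr_eq0; apply/eqP/inner_self_eq0.
rewrite innerBl Nx; last exact: orthoproj_sub.
by rewrite (inner_eq0C (orthoproj_sub x (NP.1 x))) subr0.
Qed.

Lemma orthoproj_projection : projection P.
Proof.
split; last exact: orthoproj_selfadjoint.
  by exists 1 => x; rewrite mul1r orthoproj_le.
by move=> x; rewrite orthoproj_id//; exact: NP.1.
Qed.

End one_subspace.

Section two_subspaces.
Variables (N M : set H) (P Q : {linear H -> H}).
Hypotheses (cN : closed_subspace N) (cM : closed_subspace M).
Hypotheses (NP : orthoproj N P) (MQ : orthoproj M Q).

Lemma orthoproj_orthocomp_dense : N `&` M = [set 0] ->
  forall n (e : R), N n -> 0 < e ->
  exists2 u, orthocomp M u & rnorm (n - P u) < e.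
Proof.
move=> NM n e Nn e0.
(* K is the closure of the range of P on the orthocomplement of M; a vector of N
   orthogonal to K is orthogonal to that orthocomplement, hence lies in M. *)
pose K := [set x | forall e : R, 0 < e ->
  exists2 u, orthocomp M u & rnorm (x - P u) < e].
have cMo := orthocomp_closed M.
have KP u : orthocomp M u -> K (P u).
  by move=> Mu t t0; exists u => //; rewrite subrr rnorm0.
have cK : closed_subspace K.
  split=> [|a x y Kx Ky t t0|].
  - by rewrite -(linear0 P); apply: KP; exact: subspace0.
  - have a0 : 0 < rnorm a + 1 by rewrite ltr_wpDl// rnorm_ge0.
    have [|u Mu xu] := Kx (t / (rnorm a + 1) / 2); first by rewrite !divr_gt0.
    have [|v Mv yv] := Ky (t / 2); first by rewrite divr_gt0.
    exists (a *: u + v); first by case: cMo => _ + _; exact.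
    rewrite linearP opprD addrACA -scalerBr (splitr t).
    apply: le_lt_trans (rnormD _ _) _; apply: ler_ltD => //.
    rewrite rnormZ -[leRHS](divfK (lt0r_neq0 a0)) mulrC (mulrAC t).
    by rewrite ler_pM ?rnorm_ge0 ?lerDl// ltW.
  - apply/closed_rnormP => x Kx t t0.
    have t20 : 0 < t / 2 by rewrite divr_gt0.
    have [y Ky xy] := Kx _ t20; have [u Mu yu] := Ky _ t20.
    exists u => //; rewrite (splitr t) -(subrK y x) -addrA.
    by apply: le_lt_trans (rnormD _ _) _; exact: ltrD.
have sKN x : K x -> N x.
  move=> Kx; case: cN => _ _ /closed_rnormP; apply=> t /Kx[u _ xu].
  by exists (P u) => //; exact: NP.1.
have [S KS] := orthoproj_exists cK.
suff -> : n = S n by have := KS.1 n; exact.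
apply/eqP; rewrite -subr_eq0; apply/eqP.
have Nz : N (n - S n) by apply: subspaceB => //; apply: sKN; exact: KS.1.
suff : (N `&` M) (n - S n) by rewrite NM.
split=> //; apply: (orthocompK MQ) => u Mu.
by rewrite -(orthoproj_id cN NP Nz) (orthoproj_selfadjoint NP) KS.2//; exact: KP.
Qed.

(** Both sides of the bound are continuous, and the vectors [P u] with [u] orthogonal to [M] are
    dense in [N]. Replacing [n] by [P u] costs [d * rnorm (n - P u)] on the left and at most
    [rnorm (n - P u)] on the right, whence the factor [d + 1]. *)
Lemma orthoproj_lower_bound (d : R) : N `&` M = [set 0] -> 0 <= d ->
  (forall u, orthocomp M u -> d * rnorm (P u) <= rnorm (P u - Q (P u))) ->
  forall n, N n -> d * rnorm n <= rnorm (n - Q n).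
Proof.
move=> NM d0 dP n Nn.
suff near_n (e : R) : 0 < e -> d * rnorm n <= rnorm (n - Q n) + (d + 1) * e.
  apply/ler_addgt0Pr => e e0.
  have d1 : 0 < d + 1 by rewrite ltr_wpDl.
  apply: le_trans (near_n (e / (d + 1)) _) _; first by rewrite divr_gt0.
  by rewrite [_ * (e / _)]mulrC divfK ?gt_eqF.
move=> e0; have [u Mu nu] := orthoproj_orthocomp_dense NM Nn e0.
have h1 := dP u Mu.
have : rnorm n <= rnorm (P u) + rnorm (n - P u).
  by rewrite -{1}(subrK (P u) n) addrC rnormD.
have : rnorm (P u - Q (P u)) <= rnorm (n - Q n) + rnorm (n - P u).
  have -> : P u - Q (P u) = (n - Q n) - ((n - P u) - Q (n - P u)).
    by rewrite (linearB Q)/= opprB !addrA subrK opprB [RHS]addrC addrA subrK.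
  apply: le_trans (rnormB _ _) _; rewrite lerD2l.
  exact: (orthoproj_sub_le MQ).
nra.
Qed.

(** Let sums of elements of [N] and [M] approach [x]. The difference of two [N]-components has
    distance to [M] at most the distance between the two sums, so the hypothesis makes the
    [N]-components Cauchy. Their limit is in [N], and [x] minus it is a limit of the
    [M]-components. *)
Lemma sum_closed (d : R) : 0 < d ->
  (forall n, N n -> d * rnorm n <= rnorm (n - Q n)) ->
  closed [set x + y | x in N & y in M].
Proof.
move=> d0 dN; apply/closed_rnormP => x xNM.
have /choice[v vP] : forall k : nat, exists v : H * H,
    [/\ N v.1, M v.2 & rnorm (x - (v.1 + v.2)) < k.+1%:R^-1].
  move=> k; have [_ [n Nn [m Mm <-]] xk] := xNM k.+1%:R^-1 ltac:(by []).
  by exists (n, m).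
have [n vn] : exists n, rconverges (fst \o v) n.
  apply: rcauchy_converges => e e0.
  have [|k ke] := @invS_small R (d * e / 2); first by rewrite divr_gt0 ?mulr_gt0.
  exists k => l kl /=; have [[Nk Mk xk] [Nl Ml xl]] := (vP k, vP l).
  rewrite -(ltr_pM2l d0); apply: le_lt_trans (dN _ (subspaceB cN Nk Nl)) _.
  have : rnorm ((v k).1 - (v l).1 - Q ((v k).1 - (v l).1)) <=
      rnorm ((x - ((v l).1 + (v l).2)) - (x - ((v k).1 + (v k).2))).
    have -> : (x - ((v l).1 + (v l).2)) - (x - ((v k).1 + (v k).2)) =
        ((v k).1 - (v l).1) - ((v l).2 - (v k).2).
      by rewrite opprB [LHS]addrC addrA subrK opprD addrACA opprB.
    by apply: (orthoproj_nearest cM MQ); exact: subspaceB.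
  move/le_lt_trans; apply; apply: le_lt_trans (rnormB _ _) _.
  rewrite (splitr (d * e)); apply: ltrD; [exact: lt_trans xl (ke _ kl)|].
  exact: lt_trans xk (ke _ (leqnn _)).
have Nn : N n.
  by apply: closed_rconverges vn => [|k]; [case: cN | have [] := vP k].
exists n => //; exists (x - n); last by rewrite addrC subrK.
case: cM => _ _ /closed_rnormP; apply => e e0.
have e20 : 0 < e / 2 by rewrite divr_gt0.
have [[k kt] [l nl]] := (invS_small e20, vn _ e20).
pose j := maxn k l; exists (v j).2; first by have [] := vP j.
have -> : x - n - (v j).2 = (x - ((v j).1 + (v j).2)) - (n - (v j).1).
  by rewrite opprB addrA opprD addrA (addrAC (x - _)) subrK addrAC.
apply: le_lt_trans (rnormB _ _) _; rewrite (splitr e).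
apply: ltrD; last by apply: nl; exact: leq_maxr.
by have [_ _ /lt_trans] := vP j; apply; apply: kt; exact: leq_maxl.
Qed.

End two_subspaces.
End orthoproj.

(** * The algebra leaving N and M invariant *)

Section operators.
Context {R : realType} {H : hilbertType R}.
Implicit Types (x y u v : H) (N M : set H) (T L : {linear H -> H}).

Lemma opnorm_le T (c : R) : 0 <= c -> (forall x, rnorm (T x) <= c * rnorm x) ->
  opnorm T <= c.
Proof.
move=> c0 Tc; apply: ge_sup => [|_ [x /= x1 <-]].
  by exists (rnorm (T 0)), 0 => //=; rewrite rnorm0.
by rewrite (le_trans (Tc x))// ler_piMr.
Qed.

(** Boundedness makes [opnorm T] a genuine supremum rather than the default value of [sup]; the
    bound on the unit ball then extends by scaling. *)
Lemma contractionP T : bounded_operators T -> opnorm T <= 1 ->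
  forall x, rnorm (T x) <= rnorm x.
Proof.
move=> [c Tc] T1 x; have [->|x0] := eqVneq x 0; first by rewrite linear0.
have {}x0 : 0 < rnorm x by rewrite rnorm_gt0.
pose t := (rnorm x)^-1; have t0 : 0 < t by rewrite invr_gt0.
have : rnorm (T (t%:C *: x)) <= 1.
  apply: le_trans T1; apply: ub_le_sup.
    exists `|c| => _ [y /= y1 <-]; apply: le_trans (Tc y) _.
    apply: le_trans (ler_wpM2r (rnorm_ge0 y) (ler_norm c)) _.
    by rewrite ler_piMr.
  exists (t%:C *: x) => //=.
  by rewrite rnormZ rnormC gtr0_norm// mulVf ?gt_eqF.
by rewrite linearZ rnormZ rnormC gtr0_norm// mulrC ler_pdivrMr// mul1r.
Qed.

Definition rank_one_fun u v x : H := inner x v *: u.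

Lemma rank_one_linear u v : linear (rank_one_fun u v).
Proof.
by move=> a x y; rewrite /rank_one_fun innerDl innerZl scalerDl scalerA.
Qed.

HB.instance Definition _ u v :=
  GRing.isLinear.Build _ _ _ _ (rank_one_fun u v) (rank_one_linear u v).

Definition rank_one u v : {linear H -> H} := rank_one_fun u v.

Lemma rank_oneE u v x : rank_one u v x = inner x v *: u. Proof. by []. Qed.

Lemma rank_one_bound u v x :
  rnorm (rank_one u v x) <= rnorm u * rnorm v * rnorm x.
Proof.
rewrite rank_oneE rnormZ mulrC -mulrA ler_wpM2l ?rnorm_ge0// mulrC.
exact: cauchy_schwarz.
Qed.

Lemma invariant_algebraC N M : invariant_algebra N M = invariant_algebra M N.
Proof. by apply/seteqP; split=> T []. Qed.

Lemma rank_one_invariant N M u v : closed_subspace N -> closed_subspace M ->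
  N u -> orthocomp M v -> invariant_algebra N M (rank_one u v).
Proof.
move=> cN cM Nu Mv; split.
- by exists (rnorm u * rnorm v); exact: rank_one_bound.
- by move=> _ [x _ <-]; exact: subspaceZ.
- move=> _ [x Mx <-]; rewrite rank_oneE (inner_eq0C (Mv x Mx)) scale0r.
  exact: subspace0.
Qed.

(** Written as a rank-one operator, so that its membership in the algebra is a case of
    [rank_one_invariant]. *)
Definition zero_operator : {linear H -> H} := rank_one 0 0.

Lemma zero_operatorE x : zero_operator x = 0. Proof. exact: scaler0. Qed.

Lemma zero_operator_invariant N M : closed_subspace N -> closed_subspace M ->
  invariant_algebra N M zero_operator.
Proof.
move=> cN cM; apply: rank_one_invariant => //; first exact: subspace0.
by apply: subspace0; exact: orthocomp_closed.
Qed.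

Lemma opnorm_zero : opnorm zero_operator <= 1.
Proof.
by apply: opnorm_le => // x; rewrite zero_operatorE rnorm0 mul1r rnorm_ge0.
Qed.

Lemma omega_norm_ge N M x y T : invariant_algebra N M T -> opnorm T <= 1 ->
  rnorm (inner (T x) y) <= omega_norm (invariant_algebra N M) x y.
Proof.
move=> AT T1; apply: ub_le_sup; last by exists T.
exists (rnorm x * rnorm y) => _ [S /= [[bS _ _] S1] <-].
apply: le_trans (cauchy_schwarz _ _) _; rewrite ler_wpM2r ?rnorm_ge0//.
exact: contractionP.
Qed.

Lemma omega_norm_le N M x y (b : R) : closed_subspace N -> closed_subspace M ->
  (forall T, invariant_algebra N M T -> (forall z, rnorm (T z) <= rnorm z) ->
    rnorm (inner (T x) y) <= b) ->
  omega_norm (invariant_algebra N M) x y <= b.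
Proof.
move=> cN cM Ab; apply: ge_sup => [|_ [T /= [AT T1] <-]].
  exists (rnorm (omega x y zero_operator)), zero_operator => //=; split.
    exact: zero_operator_invariant.
  exact: opnorm_zero.
by apply: Ab => //; apply: contractionP => //; case: AT.
Qed.

Lemma omega_norm_ge0 N M x y : closed_subspace N -> closed_subspace M ->
  0 <= omega_norm (invariant_algebra N M) x y.
Proof.
move=> cN cM; have A0 := zero_operator_invariant cN cM.
exact: le_trans (rnorm_ge0 _) (omega_norm_ge x y A0 opnorm_zero).
Qed.

(** Test with the rank-one operator built from [u = P y] and [v = x - Q x], divided by
    [rnorm u * rnorm v]. Since [inner x v] and [inner u y] are the squared norms of [v] and [u], its
    value is the product of the norms. *)
Lemma omega_norm_ge_orthoproj N M (P Q : {linear H -> H}) x y :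
  closed_subspace N -> closed_subspace M -> orthoproj N P -> orthoproj M Q ->
  rnorm (x - Q x) * rnorm (P y) <= omega_norm (invariant_algebra N M) x y.
Proof.
move=> cN cM NP MQ; have := omega_norm_ge0 x y cN cM.
set u := P y; set v := x - Q x.
have [->|v0] := eqVneq v 0; first by rewrite rnorm0 mul0r.
have [->|u0] := eqVneq u 0; first by rewrite rnorm0 mulr0.
move=> _.
have {}u0 : 0 < rnorm u by rewrite rnorm_gt0.
have {}v0 : 0 < rnorm v by rewrite rnorm_gt0.
pose k := (rnorm u * rnorm v)^-1.
have k0 : 0 < k by rewrite invr_gt0 mulr_gt0.
have Nu : N u by exact: NP.1.
have Mv : orthocomp M v by exact: MQ.2.
have -> : rnorm v * rnorm u = rnorm (inner (rank_one (k%:C *: u) v x) y).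
  rewrite rank_oneE !innerZl.
  have -> : inner x v = (rnorm v ^+ 2)%:C :> R[i].
    by rewrite -inner_self [RHS]innerBl (inner_eq0C (Mv _ (MQ.1 x))) subr0.
  have -> : inner u y = (rnorm u ^+ 2)%:C :> R[i].
    rewrite -inner_self -[in LHS](orthoproj_id cN NP Nu).
    by rewrite (orthoproj_selfadjoint NP).
  rewrite -!rmorphM/= rnormC ger0_norm.
    by rewrite /k; field; rewrite !gt_eqF.
  by rewrite !mulr_ge0// ?sqr_ge0// ltW.
apply: omega_norm_ge.
  by apply: rank_one_invariant => //; exact: subspaceZ.
apply: opnorm_le => // z; apply: le_trans (rank_one_bound _ _ _) _.
by rewrite rnormZ rnormC gtr0_norm// -(mulrA k) mulVf ?gt_eqF ?mulr_gt0.
Qed.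

(* The rank-one operators of the algebra already determine its lattice: if some
   L x has a component along v orthogonal to M, then rank_one u v, with u in N,
   forces u into the range of L. *)
Lemma Lat_dichotomy N M (Q : {linear H -> H}) L :
  closed_subspace N -> closed_subspace M -> orthoproj M Q ->
  Lat (invariant_algebra N M) L ->
  (forall u, N u -> L u = u) \/ (forall x, M (L x)).
Proof.
move=> cN cM MQ [_ LA].
have [ML|/existsNP[x nMLx]] := pselect (forall x, M (L x)); first by right.
left=> u Nu; have [v Mv Lxv] : exists2 v, orthocomp M v & inner (L x) v != 0.
  apply: contrapT => nv; apply: nMLx; apply: (orthocompK MQ) => v Mv.
  by apply/eqP/negP => /negP xv; apply: nv; exists v.
have := LA _ (rank_one_invariant cN cM Nu Mv) x.
rewrite rank_oneE linearZ/= -scalerBr => /eqP.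
by rewrite scaler_eq0 (negPf Lxv)/= subr_eq0 => /eqP.
Qed.

(** The dichotomy is applied to the pair in both orders. If [L] fixes both subspaces, [x - L x] is
    orthogonal to both and vanishes; if its range lies in both, [L] is 0; in the mixed cases [L] is
    the projection onto the subspace that it fixes. *)
Lemma Lat_generic N M (P Q : {linear H -> H}) L :
  closed_subspace N -> closed_subspace M -> orthoproj N P -> orthoproj M Q ->
  generic_position N M -> Lat (invariant_algebra N M) L ->
  [\/ forall x, L x = 0, forall x, L x = x, orthoproj N L | orthoproj M L].
Proof.
move=> cN cM NP MQ [NM _ _ NMo] LL.
have [[_ _ Lsa] _] := LL.
have fix_orth (K : set H) : (forall u, K u -> L u = u) ->
    forall x, orthocomp K (x - L x).
  by move=> LK x u Ku; rewrite innerBl Lsa LK// subrr.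
case: (Lat_dichotomy cN cM MQ LL) => LN;
  move: (LL); rewrite invariant_algebraC => /(Lat_dichotomy cM cN NP)[] LM.
- apply: Or42 => x; apply/esym/eqP; rewrite -subr_eq0; apply/eqP.
  suff : (orthocomp M `&` orthocomp N) (x - L x) by rewrite NMo.
  by split; exact: fix_orth.
- by apply: Or43; split=> //; exact: fix_orth.
- by apply: Or44; split=> //; exact: fix_orth.
- by apply: Or41 => x; suff : (N `&` M) (L x) by rewrite NM.
Qed.

Lemma zero_operator_Lat (A : set {linear H -> H}) : Lat A zero_operator.
Proof.
split=> [|T _ x]; last by rewrite !zero_operatorE linear0 subrr.
split=> [|x|x y]; rewrite ?zero_operatorE ?inner0l ?inner0r//.
by exists 0 => x; rewrite zero_operatorE rnorm0 mul0r.
Qed.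

Lemma idfun_Lat (A : set {linear H -> H}) : Lat A idfun.
Proof.
split=> [|T _ x]; last by rewrite /= subrr.
by split=> //; exists 1 => x; rewrite mul1r.
Qed.

Lemma orthoproj_Lat N M (P : {linear H -> H}) : closed_subspace N ->
  orthoproj N P -> Lat (invariant_algebra N M) P.
Proof.
move=> cN NP; split=> [|T [_ TN _] x]; first exact: orthoproj_projection NP.
apply/eqP; rewrite subr_eq0; apply/eqP/esym/(orthoproj_id cN NP).
by apply: TN; exists (P x) => //; exact: NP.1.
Qed.

End operators.

(** * Zero angle *)

Section zero_angle.
Context {R : realType} {H : hilbertType R}.
Implicit Types (N M : set H).

Lemma scalec_halfD (x : H) : (2^-1 : R)%:C *: (x + x) = x.
Proof.
rewrite -mulr2n -[x *+ 2]scaler_nat scalerA -(rmorph_nat (real_complex R)).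
by rewrite -rmorphM/= mulVf ?scale1r// pnatr_eq0.
Qed.

(** Expanding the second hypothesis, with the first, gives [inner (T s) w = inner (T p) w - inner (T
    p) u]. So [inner (T (s + p)) (u + w)] is twice [inner (T p) w]. *)
Lemma inner_midpoint (T : {linear H -> H}) (s p u w : H) :
  inner (T s) u = 0 -> inner (T (s - p)) (u - w) = 0 ->
  inner (T (s + p)) ((2^-1 : R)%:C *: (u + w)) = inner (T p) w.
Proof.
rewrite (linearB T) (linearD T)/= innerZr.
rewrite !innerBl !innerDl !innerBr !innerDr => ->.
rewrite !add0r => /eqP; rewrite subr_eq0 => /eqP e.
have -> : inner (T s) w = inner (T p) w - inner (T p) u.
  by rewrite -opprB -e opprK.
rewrite addrA subrK -mulr2n -[inner _ _ *+ 2]mulr_natl mulrA.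
rewrite (_ : Num.conj _ * _ = 1) ?mul1r//.
rewrite fmorphV/= rmorph_nat fmorphV rmorph_nat.
by rewrite mulVf// pnatr_eq0.
Qed.

Lemma positive_angle_of_property_V' N M :
  closed_subspace N -> closed_subspace M -> generic_position N M ->
  property_V' (invariant_algebra N M) -> positive_angle N M.
Proof.
move=> cN cM genNM [c c0 V'c]; apply: contrapT => nclosed.
have [P NP] := orthoproj_exists cN; have [Q MQ] := orthoproj_exists cM.
(* The bound 1/4 keeps [Q w] long and [p] short compared with [w]; the bound [(32 * c)^-1] brings
   [c * (d * rnorm w ^+ 2)] below the lower estimate [rnorm w ^+ 2 / 16]. *)
pose d := Num.min 4^-1 (32 * c)^-1.
have d0 : 0 < d by rewrite lt_min !invr_gt0 ltr0n mulr_gt0.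
have d4 : d <= 4^-1 by rewrite ge_min lexx.
have cd : c * d <= 32^-1.
  apply: (@le_trans _ _ (c * (32 * c)^-1)).
    by rewrite ler_pM2l// ge_min lexx orbT.
  by rewrite invfM mulrCA mulfV ?mulr1// gt_eqF.
(* Otherwise the reverse bound would extend to all of [N] and make [N + M] closed. *)
have [u Mu ud] : exists2 u, orthocomp M u &
    rnorm (P u - Q (P u)) < d * rnorm (P u).
  apply: contrapT => nu; apply: nclosed; apply: (sum_closed cN cM MQ d0).
  apply: (orthoproj_lower_bound cN NP MQ _ (ltW d0)); first by case: genNM.
  by move=> u Mu; rewrite leNgt; apply/negP => ud; apply: nu; exists u.
pose w := P u; rewrite -/w in ud.
have Nw : N w by exact: NP.1.
have w0 : 0 < rnorm w.
  by have := le_lt_trans (rnorm_ge0 _) ud; rewrite pmulr_rgt0.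
pose p := Q w - P (Q w); pose x := Q w + p.
pose y := (2^-1 : R)%:C *: (u + w).
have pw : rnorm p <= d * rnorm w.
  apply: le_trans (ltW ud); rewrite (rdistC w).
  exact: (orthoproj_nearest cN NP).
have omega_xy : omega_norm (invariant_algebra N M) x y <= d * rnorm w ^+ 2.
  apply: omega_norm_le => // T [_ TN TM] T1.
  have xu : inner (T (Q w)) u = 0.
    by apply: inner_eq0C; apply: Mu; apply: TM; exists (Q w) => //; exact: MQ.1.
  (* Here [Q w - p] is [P (Q w)], which [T] keeps in [N], while [u - w = u - P u] is orthogonal to
     [N]. *)
  have -> : inner (T x) y = inner (T p) w.
    apply: inner_midpoint => //; apply: inner_eq0C; apply: (orthoproj_sub NP).
    by rewrite /p subKr; apply: TN; exists (P (Q w)) => //; exact: NP.1.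
  apply: le_trans (cauchy_schwarz _ _) _; rewrite expr2 mulrA.
  by rewrite ler_wpM2r ?rnorm_ge0//; exact: le_trans (T1 p) pw.
have Qw : 3 / 4 * rnorm w <= rnorm (Q w).
  have := rnormD (Q w) (w - Q w); rewrite subrKC.
  have : d * rnorm w <= 4^-1 * rnorm w by rewrite ler_wpM2r ?rnorm_ge0.
  by move: ud; lra.
have Py : P y = w.
  by rewrite /y linearZ linearD/= (orthoproj_id cN NP Nw) scalec_halfD.
(* In each case one of the two terms suffices. The norm of [x] is at least [rnorm w / 2] for
   [L = 0]; [P y = w] serves for the identity and for [P]; and [Q y] is half of [Q w], as
   [Q u = 0]. *)
have low L : Lat (invariant_algebra N M) L ->
    rnorm w ^+ 2 / 16 <= rnorm (x - L x) ^+ 2 + rnorm (L y) ^+ 2.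
  have bnd (r s : R) : 4^-1 * rnorm w <= r ->
      rnorm w ^+ 2 / 16 <= r ^+ 2.
    move=> wr; have -> : rnorm w ^+ 2 / 16 = (4^-1 * rnorm w) ^+ 2 by field.
    by rewrite ler_sqr// nnegrE ?mulr_ge0 ?(le_trans _ wr) ?mulr_ge0 ?rnorm_ge0.
  move=> /(Lat_generic cN cM NP MQ genNM)[L0|L1|NL|ML].
  - apply: ler_wpDr; first exact: sqr_ge0.
    rewrite L0 subr0; apply: bnd => //.
    have := rnormB x p; rewrite /x addrK.
    have : d * rnorm w <= 4^-1 * rnorm w by rewrite ler_wpM2r ?rnorm_ge0.
    by move: Qw pw; lra.
  - apply: ler_wpDl; first exact: sqr_ge0.
    rewrite L1; apply: bnd => //; have := orthoproj_le NP y; rewrite Py.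
    by lra.
  - apply: ler_wpDl; first exact: sqr_ge0.
    apply: bnd => //; have -> : L y = w.
      rewrite -Py; apply: (orthoproj_uniq cN NL); first exact: NP.1.
      exact: (orthoproj_sub NP).
    by lra.
  - apply: ler_wpDl; first exact: sqr_ge0.
    apply: bnd => //; have -> : L y = (2^-1 : R)%:C *: Q w.
      rewrite /y linearZ linearD/= (orthoproj_eq0 cM ML Mu) add0r.
      congr (_ *: _); apply: (orthoproj_uniq cM ML); first exact: MQ.1.
      exact: (orthoproj_sub MQ).
    by rewrite rnormZ rnormC gtr0_norm//; lra.
have : rnorm w ^+ 2 / 16 <= c * (d * rnorm w ^+ 2).
  apply: le_trans (le_trans (V'c x y) _); last by rewrite ler_pM2l.
  apply: lb_le_inf => [|_ [L LA <-]]; last exact: low.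
  exists (rnorm (x - P x) ^+ 2 + rnorm (P y) ^+ 2), P => //.
  exact: orthoproj_Lat.
rewrite mulrA leNgt => /negP; apply.
have w2 : 0 < rnorm w ^+ 2 by rewrite exprn_gt0.
have : c * d * rnorm w ^+ 2 <= 32^-1 * rnorm w ^+ 2 by rewrite ler_pM2r.
by lra.
Qed.

End zero_angle.

(** * Positive angle *)

Section uniform_boundedness.
Context {R : realType} {H : hilbertType R}.
Implicit Types (B : set H).

Let r k : R := 4^-1 ^+ k.

Let r_gt0 k : 0 < r k. Proof. by rewrite exprn_gt0. Qed.

(* Gliding hump: x is the limit of points u k with steps of length at most
   4^-k, chosen so that |inner (u k.+1) (y k)| is at least half of
   4^-k * rnorm (y k); the remaining steps have total length at most 4^-k / 3,
   which is too short to cancel this value. *)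
Lemma weakly_bounded_bounded B :
  (forall z, exists c : R, forall y, B y -> rnorm (inner z y) <= c) ->
  exists c : R, forall y, B y -> rnorm y <= c.
Proof.
move=> wB; apply: contrapT => nbB.
(* The factor 6 is what remains at the end: 1/2 from the hump minus 1/3 from the tail leaves
   [r k * rnorm (y k) / 6], which exceeds [k]. *)
have /choice[y yP] : forall k, exists y, B y /\ k%:R / r k * 6 < rnorm y.
  move=> k; apply: contrapT => ny; apply: nbB; exists (k%:R / r k * 6) => y By.
  by rewrite leNgt; apply/negP => ky; apply: ny; exists y.
have step k z : exists z', rnorm (z' - z) <= r k /\
    r k * rnorm (y k) <= 2 * rnorm (inner z' (y k)).
  have [yk0|yk0] := eqVneq (y k) 0.
    by exists z; rewrite subrr yk0 inner0r !rnorm0 !mulr0 ltW.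
  have nyk : 0 < rnorm (y k) by rewrite rnorm_gt0.
  pose v := (r k / rnorm (y k))%:C *: y k.
  have nv : rnorm v = r k.
    by rewrite rnormZ rnormC gtr0_norm ?divr_gt0// divfK ?gt_eqF.
  have vy : rnorm (inner v (y k)) = r k * rnorm (y k).
    rewrite innerZl inner_self -rmorphM/= rnormC gtr0_norm.
      by field; rewrite gt_eqF.
    by rewrite mulr_gt0 ?divr_gt0 ?exprn_gt0.
  (* The products of [z] and [z + v] with [y k] differ by [r k * rnorm (y k)], so one of them has at
     least half that modulus. *)
  have [zy|zy] := leP (r k * rnorm (y k)) (2 * rnorm (inner z (y k))).
    by exists z; split=> //; rewrite subrr rnorm0 ltW.
  exists (z + v); split; first by rewrite addrC addKr nv.
  have := rnormB (inner (z + v) (y k)) (inner z (y k)).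
  rewrite -innerBl (addrC z) addrK vy.
  by move: zy; lra.
have /choice[f fP] : forall kz : nat * H, exists z',
    rnorm (z' - kz.2) <= r kz.1 /\
    r kz.1 * rnorm (y kz.1) <= 2 * rnorm (inner z' (y kz.1)).
  by move=> [k z]; exact: step.
pose u := fix u k := if k is k'.+1 then f (k', u k') else (0 : H).
have tail n j : rnorm (u n - u (n + j)%N) <= 4 / 3 * (r n - r (n + j)%N).
  elim: j => [|j IHj]; first by rewrite addn0 !subrr rnorm0 mulr0.
  have [uj _] := fP ((n + j)%N, u (n + j)%N).
  have := rnormD (u n - u (n + j)%N) (u (n + j)%N - u (n + j.+1)%N).
  rewrite addrA subrK (rdistC (u (n + j)%N)).
  move: uj IHj; rewrite addnS /= /r exprS.
  by lra.
have {}tail n m : (n <= m)%N -> rnorm (u n - u m) <= 4 / 3 * r n.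
  move=> nm; have := tail n (m - n)%N; rewrite subnKC//.
  by have := r_gt0 m; lra.
have rsmall (e : R) : 0 < e -> exists n, 4 / 3 * r n < e.
  move=> e0; have e20 : 0 < e / 2 by rewrite divr_gt0.
  have [n _ /(_ n (leqnn n)) ne] := near_infty_natSinv_lt (PosNum e20).
  exists n.
  have : r n <= n.+1%:R^-1.
    by rewrite /r exprVn lef_pV2 ?posrE ?exprn_gt0// -natrX ler_nat ltn_expl.
  move: ne => /=; move: (_^-1) (r n) => s t.
  by lra.
have [x ux] : exists x, rconverges u x.
  apply: rcauchy_converges => e /rsmall[n ne]; exists n => m nm.
  exact: le_lt_trans (tail n m nm) ne.
have tail_lim n : rnorm (x - u n) <= 4 / 3 * r n.
  suff near_lim (e : R) : 0 < e -> rnorm (x - u n) <= 4 / 3 * r n + e.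
    exact/ler_addgt0Pr.
  move=> /ux[m um].
  have := um _ (leq_maxl m n); have := tail _ _ (leq_maxr m n).
  have := rnormB (x - u (maxn m n)) (u n - u (maxn m n)).
  rewrite opprB addrA subrK; move: (r n) => s.
  by lra.
have [c xc] := wB x.
pose k := (Num.truncn c).+1.
have [Bk yk] := yP k.
have := xc _ Bk; apply/negP; rewrite -ltNge.
apply: lt_le_trans (truncnS_gt c) _; rewrite -/k.
have [_ hk] := fP (k, u k); rewrite /= in hk.
have -> : inner x (y k) = inner (f (k, u k)) (y k) + inner (x - u k.+1) (y k).
  by rewrite -innerDl subrKC.
have := rnormB (inner (f (k, u k)) (y k) + inner (x - u k.+1) (y k))
  (inner (x - u k.+1) (y k)).
rewrite addrK.
(* The hump for [y k] is created in [u k.+1], so the tail starts one index later and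
   [4 / 3 * r k.+1] equals [r k / 3]. *)
have : rnorm (inner (x - u k.+1) (y k)) <= r k / 3 * rnorm (y k).
  apply: le_trans (cauchy_schwarz _ _) _; rewrite ler_wpM2r ?rnorm_ge0//.
  apply: le_trans (tail_lim _) _; rewrite /r exprS.
  by rewrite (_ : 4 / 3 * _ = 4^-1 ^+ k / 3)//; field.
have : k%:R * 6 < r k * rnorm (y k).
  by rewrite -ltr_pdivrMl// mulrA (mulrC _^-1).
move: hk; move: (r k) (rnorm (y k)) => s t.
by lra.
Qed.

End uniform_boundedness.

(** * From a closed sum to property (V') *)

Section positive_angle.
Context {R : realType} {H : hilbertType R}.
Implicit Types (x y : H) (N M : set H) (P Q : {linear H -> H}).

(** Being closed, [N + M] has an orthogonal projection, and a vector orthogonal to [N + M] is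
    orthogonal to both subspaces, hence 0. *)
Lemma sum_full N M : closed_subspace N -> closed_subspace M ->
  generic_position N M -> positive_angle N M ->
  forall z, exists n m, [/\ N n, M m & z = n + m].
Proof.
move=> cN cM [_ _ _ NMo] angle z.
pose S := [set x + y | x in N & y in M].
have cS : closed_subspace S.
  split=> //; first by exists 0; [|exists 0; rewrite ?addr0//]; exact: subspace0.
  move=> a _ _ [n Nn [m Mm <-]] [n' Nn' [m' Mm' <-]].
  exists (a *: n + n'); first by case: cN => _ + _; exact.
  exists (a *: m + m'); first by case: cM => _ + _; exact.
  by rewrite scalerDr addrACA.
have [T ST] := orthoproj_exists cS.
have [n Nn [m Mm Tz]] := ST.1 z; exists n, m; split=> //.
rewrite Tz; apply/eqP; rewrite -subr_eq0; apply/eqP.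
suff : (orthocomp M `&` orthocomp N) (z - T z) by rewrite NMo.
split=> y Ky; apply: ST.2.
  by exists 0; [exact: subspace0 | exists y => //; rewrite add0r].
by exists y => //; exists 0; [exact: subspace0 | rewrite addr0].
Qed.

(** The set where [rnorm (P y) + rnorm (Q y) <= 1] is weakly bounded: for [z = n + m], [inner z y =
    inner n (P y) + inner m (Q y)] has modulus at most [rnorm n + rnorm m]. Uniform boundedness and
    scaling conclude. *)
Lemma orthoproj_coercive N M P Q :
  closed_subspace N -> closed_subspace M ->
  orthoproj N P -> orthoproj M Q -> generic_position N M ->
  positive_angle N M ->
  exists2 c : R, 0 < c & forall y, rnorm y <= c * (rnorm (P y) + rnorm (Q y)).
Proof.
move=> cN cM NP MQ genNM angle.
have [z|c cB] := @weakly_bounded_bounded R H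
    [set y | rnorm (P y) + rnorm (Q y) <= 1].
  have [n [m [Nn Mm ->]]] := sum_full cN cM genNM angle z.
  exists (rnorm n + rnorm m) => y /= y1.
  rewrite innerDl -(orthoproj_id cN NP Nn) -(orthoproj_id cM MQ Mm).
  rewrite (orthoproj_selfadjoint NP) (orthoproj_selfadjoint MQ).
  rewrite (orthoproj_id cN NP Nn) (orthoproj_id cM MQ Mm).
  have := rnormD (inner n (P y)) (inner m (Q y)).
  have := cauchy_schwarz n (P y); have := cauchy_schwarz m (Q y).
  have : rnorm n * rnorm (P y) <= rnorm n.
    by rewrite ler_piMr ?rnorm_ge0//; have := rnorm_ge0 (Q y); lra.
  have : rnorm m * rnorm (Q y) <= rnorm m.
    by rewrite ler_piMr ?rnorm_ge0//; have := rnorm_ge0 (P y); lra.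
  by lra.
exists (`|c| + 1) => [|y]; first by rewrite ltr_wpDl.
set s := rnorm (P y) + rnorm (Q y).
have : 0 <= s by rewrite addr_ge0 ?rnorm_ge0.
(* Scaling by the inverse of [s] needs [s] nonzero; if [s] is 0, then [y] is orthogonal to [N] and
   [M], so it vanishes. *)
rewrite le_eqVlt => /predU1P[s0|s0].
  move: (s0) => /esym/eqP; rewrite paddr_eq0 ?rnorm_ge0// !rnorm_eq0.
  move=> /andP[/eqP Py /eqP Qy]; suff -> : y = 0 by rewrite rnorm0 -s0 mulr0.
  have [_ _ _ NMo] := genNM.
  suff : (orthocomp M `&` orthocomp N) y by rewrite NMo.
  by rewrite -[y]subr0; split; [rewrite -Qy|rewrite -Py]; exact: orthoproj_sub.
have : rnorm ((s^-1)%:C *: y) <= c.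
  apply: cB => /=; rewrite !linearZ/= !rnormZ !rnormC gtr0_norm ?invr_gt0//.
  by rewrite -mulrDr mulVf// gt_eqF.
rewrite rnormZ rnormC gtr0_norm ?invr_gt0// ler_pdivrMl// mulrC => /le_trans.
apply; rewrite ler_wpM2r ?(ltW s0)//.
by have := ler_norm c; lra.
Qed.

(* The bound c of Q on the orthocomplement of N passes to its adjoint I - P on M,
   as the range of Q on that orthocomplement is dense in M. *)
Lemma sub_orthoproj_lower_bound N M P Q (c : R) :
  closed_subspace M -> orthoproj N P -> orthoproj M Q ->
  N `&` M = [set 0] -> closed_subspace N -> 0 < c ->
  (forall y, rnorm y <= c * (rnorm (P y) + rnorm (Q y))) ->
  forall m, M m -> rnorm m <= c * rnorm (m - P m).
Proof.
move=> cM NP MQ NM cN c0 coer m Mm.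
rewrite -ler_pdivrMl//; move: m Mm.
apply: (orthoproj_lower_bound cM MQ NP); first by rewrite setIC.
  by rewrite invr_ge0 ltW.
move=> u Nu; have := coer u; rewrite (orthoproj_eq0 cN NP Nu) rnorm0 add0r => cu.
rewrite ler_pdivrMl//.
have [->|Qu0] := eqVneq (Q u) 0.
  by rewrite rnorm0 mulr_ge0 ?rnorm_ge0 ?(ltW c0).
have {}Qu0 : 0 < rnorm (Q u) by rewrite rnorm_gt0.
rewrite -(ler_pM2r Qu0) -expr2.
(* The term [P (Q u)] contributes nothing, since [u] is orthogonal to [N], and [inner (Q u) u] is
   the squared norm of [Q u]. *)
have -> : rnorm (Q u) ^+ 2 = rnorm (inner (Q u - P (Q u)) u).
  rewrite innerBl (inner_eq0C (Nu _ (NP.1 _))) subr0.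
  rewrite -[in RHS](orthoproj_id cM MQ (MQ.1 u)) (orthoproj_selfadjoint MQ).
  by rewrite inner_self rnormC ger0_norm// sqr_ge0.
apply: le_trans (cauchy_schwarz _ _) _.
by rewrite [leRHS]mulrAC [leRHS]mulrC ler_wpM2l ?rnorm_ge0.
Qed.

Lemma property_V'_of_positive_angle N M :
  closed_subspace N -> closed_subspace M -> generic_position N M ->
  positive_angle N M -> property_V' (invariant_algebra N M).
Proof.
move=> cN cM genNM angle.
have [P NP] := orthoproj_exists cN; have [Q MQ] := orthoproj_exists cM.
have [c c0 coer] := orthoproj_coercive cN cM NP MQ genNM angle.
have NM : N `&` M = [set 0] by case: genNM.
have subP := sub_orthoproj_lower_bound cM NP MQ NM cN c0 coer.
have subQ : forall n, N n -> rnorm n <= c * rnorm (n - Q n).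
  apply: (sub_orthoproj_lower_bound cN MQ NP _ cM c0); first by rewrite setIC.
  by move=> y; rewrite addrC.
(* The summand [4 * c ^+ 2] serves [L = 0] and the identity, through
   [(s + t) ^+ 2 <= 2 * (s ^+ 2 + t ^+ 2)]; the summand 2 serves [P] and [Q], where two squares are
   each at most [w]. *)
exists (4 * c ^+ 2 + 2) => [|x y]; first by rewrite ltr_wpDl// mulr_ge0// sqr_ge0.
pose a := rnorm (x - Q x); pose b := rnorm (x - P x).
pose p := rnorm (P y); pose q := rnorm (Q y).
(* Writing [x = n + m], the map [x - Q x] sees only [n] and [x - P x] only [m], so the lower bounds
   on [N] and [M] add up. *)
have x_ab : rnorm x <= c * (a + b).
  have [n [m [Nn Mm xE]]] := sum_full cN cM genNM angle x.
  have -> : a = rnorm (n - Q n).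
    rewrite /a xE (linearD Q)/= (orthoproj_id cM MQ Mm).
    by rewrite opprD addrACA subrr addr0.
  have -> : b = rnorm (m - P m).
    rewrite /b xE (linearD P)/= (orthoproj_id cN NP Nn).
    by rewrite opprD addrACA subrr add0r.
  rewrite xE mulrDr; apply: le_trans (rnormD _ _) _.
  by apply: lerD; [exact: subQ | exact: subP].
have y_pq : rnorm y <= c * (p + q) by exact: coer.
set w := omega_norm _ x y.
have ap : a * p <= w by exact: omega_norm_ge_orthoproj.
have bq : b * q <= w.
  by rewrite /w invariant_algebraC; exact: omega_norm_ge_orthoproj.
have pa : p * a <= w by rewrite mulrC.
have qb : q * b <= w by rewrite mulrC.
have := rnorm_ge0 (x - Q x); rewrite -/a => a0.
have := rnorm_ge0 (x - P x); rewrite -/b => b0.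
have := rnorm_ge0 (P y); rewrite -/p => p0.
have := rnorm_ge0 (Q y); rewrite -/q => q0.
have inf_le L : Lat (invariant_algebra N M) L ->
  forall t, rnorm (x - L x) ^+ 2 + rnorm (L y) ^+ 2 <= t ->
  inf [set rnorm (x - L x) ^+ 2 + rnorm (L y) ^+ 2
      | L in Lat (invariant_algebra N M)] <= t.
  move=> LA t; apply: le_trans; apply: ge_inf; last by exists L.
  by exists 0 => _ [L' _ <-]; rewrite addr_ge0// sqr_ge0.
have w0 : 0 <= w by exact: omega_norm_ge0.
have cw : 0 <= c ^+ 2 * w by rewrite mulr_ge0// sqr_ge0.
have sqr_sum (s t v : R) : 0 <= s -> 0 <= t -> 0 <= v -> v <= c * (s + t) ->
    s ^+ 2 <= w -> t ^+ 2 <= w -> v ^+ 2 <= (4 * c ^+ 2 + 2) * w.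
  move=> s0 t0 v0 vst sw tw.
  have : v ^+ 2 <= c ^+ 2 * (s + t) ^+ 2.
    by rewrite -exprMn ler_sqr ?nnegrE// mulr_ge0 ?addr_ge0// ltW.
  have : c ^+ 2 * (s + t) ^+ 2 <= c ^+ 2 * (4 * w).
    rewrite ler_wpM2l ?sqr_ge0//.
    by have := sqr_ge0 (s - t); rewrite sqrrB sqrrD; lra.
  by lra.
have two_sum (s t : R) : s ^+ 2 <= w -> t ^+ 2 <= w ->
    s ^+ 2 + t ^+ 2 <= (4 * c ^+ 2 + 2) * w.
  by lra.
have sqr_le (s t : R) : 0 <= s -> s <= t -> s * t <= w -> s ^+ 2 <= w.
  by move=> s0 st; apply: le_trans; rewrite expr2 ler_wpM2l.
(* Whichever of the four inequalities hold, the choice of L turns its two terms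
   into min(a, p)^2 + min(b, q)^2 up to a constant, hence at most 2 w. *)
have [lap|/ltW lpa] := leP a p; have [lbq|/ltW lqb] := leP b q.
- apply: (inf_le zero_operator); first exact: zero_operator_Lat.
  rewrite !zero_operatorE subr0 rnorm0 expr0n/= addr0.
  apply: (sqr_sum a b) => //; first exact: rnorm_ge0.
    exact: sqr_le lap ap.
  exact: sqr_le lbq bq.
- apply: (inf_le Q); first by rewrite invariant_algebraC; exact: orthoproj_Lat.
  by apply: two_sum; [exact: sqr_le lap ap|exact: sqr_le lqb qb].
- apply: (inf_le P); first exact: orthoproj_Lat.
  by apply: two_sum; [exact: sqr_le lbq bq|exact: sqr_le lpa pa].
- apply: (inf_le idfun); first exact: idfun_Lat.
  rewrite /= subrr rnorm0 expr0n/= add0r.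
  apply: (sqr_sum p q) => //; first exact: rnorm_ge0.
    exact: sqr_le lpa pa.
  exact: sqr_le lqb qb.
Qed.

End positive_angle.

Theorem theorem3p4 (R : realType) (H : hilbertType R) (N M : set H)
    (closedN : closed_subspace N) (closedM : closed_subspace M)
    (genNM : generic_position N M) :
  property_V' (invariant_algebra N M) <-> positive_angle N M.
Proof.
split; first exact: positive_angle_of_property_V'.
exact: property_V'_of_positive_angle.
Qed.
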